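(* Every graph $G$ with maximum degree at most $5$ has an acyclic $\mathcal{D}_1^{(5)}$-colouring, i.e. a colouring $c:V(G)\to\{1,\dots,5\}$ such that each colour class induces a forest and for every two distinct colours $i,j$ the subgraph consisting of all edges joining a vertex of colour $i$ to a vertex of colour $j$ is acyclic.
   Context: All graphs are finite and simple. Colourings are not required to be proper. $\mathcal{D}_1$ denotes the class of acyclic graphs (forests). *)

(* Defs.v *)
From mathcomp Require Import all_boot.
Set Implicit Arguments. Unset Strict Implicit. Unset Printing Implicit Defensive.

Definition simple_graph (T : finType) (e : rel T) : Prop :=
  symmetric e /\ irreflexive e.

Definition deg (T : finType) (e : rel T) (x : T) : nat := #|[set y | e x y]|.

Definition has_cycle (T : finType) (e : rel T) : Prop :=
  exists s : seq T, 3 <= size s /\ ucycle e s.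

Definition acyclic (T : finType) (e : rel T) : Prop := ~ has_cycle e.

Definition class_rel (T : finType) (e : rel T) (k : nat) (c : T -> 'I_k)
  (i : 'I_k) : rel T := fun x y => [&& e x y, c x == i & c y == i].

Definition bicol_rel (T : finType) (e : rel T) (k : nat) (c : T -> 'I_k)
  (i j : 'I_k) : rel T :=
  fun x y => e x y && (((c x == i) && (c y == j)) || ((c x == j) && (c y == i))).

Definition acyclic_D1_colouring (T : finType) (e : rel T) (k : nat)
  (c : T -> 'I_k) : Prop :=
  (forall i : 'I_k, acyclic (class_rel e c i)) /\
  (forall i j : 'I_k, i != j -> acyclic (bicol_rel e c i j)).

(* Main.v *)
(* A cycle of alternating colours i, j (with i = j allowed, which is the
   monochromatic case) passes only through vertices having two neighbours of the
   same colour. Take a partial colouring without such cycles and with as few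
   uncoloured vertices as possible, and suppose that v is uncoloured. No colour k
   can be given to v, so for each k there are two neighbours of v of equal colour
   which both have a further neighbour coloured k. There are two ways to move to
   another minimal colouring: recolour a neighbour u of v (always possible when the
   other neighbours of u have distinct colours), or colour v and make some u the
   uncoloured vertex instead. The multiset of the colours around v is refuted in
   the order (2,1,1,1), (3,1,1), (2,2,1), (4,1), (3,2), (5), each time by counting
   colours at distance two and moving to a case already refuted. *)
Require Import Defs.
From mathcomp Require Import all_boot.
From mathcomp Require Import zify.
From Stdlib Require Import Classical.
Set Implicit Arguments. Unset Strict Implicit. Unset Printing Implicit Defensive.

(** * Counting with functions on the five colours *)

Definition supp_size (f : 'I_5 -> nat) : nat := \sum_k (0 < f k).

(** Every colour of the support takes at least one unit of the sum, so what [a] and [b] hold beyond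
    one unit comes on top. *)
Lemma supp_size_le2 (f : 'I_5 -> nat) (a b : 'I_5) :
  a != b -> supp_size f + (f a).-1 + (f b).-1 <= \sum_k f k.
Proof.
move=> ab; have ba : b != a by rewrite eq_sym.
rewrite /supp_size (bigD1 a) //= (bigD1 b) //=.
rewrite [\sum_k f k](bigD1 a) //= [\sum_(k | k != a) f k](bigD1 b) //=.
set A := (X in _ + (_ + X) + _ + _); set B := (X in _ <= _ + (_ + X)).
have : A <= B by apply: leq_sum => k _; case: (f k).
lia.
Qed.

Lemma supp_size_le (f : 'I_5 -> nat) (a : 'I_5) :
  supp_size f + (f a).-1 <= \sum_k f k.
Proof.
have [b ab] : exists b, a != b.
  by exists (if a == ord0 then ord_max else ord0); case: ifP => // [/eqP->|->].
by have := supp_size_le2 f ab; lia.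
Qed.

Lemma supp_size_lt5 (f : 'I_5 -> nat) :
  supp_size f < 5 -> exists k, f k = 0.
Proof.
move=> h; have /existsP[k /eqP fk] : [exists k, f k == 0]; last by exists k.
apply: contraLR h; rewrite negb_exists => /forallP h; rewrite -leqNgt.
rewrite -[X in X <= _](card_ord 5) -sum1_card; apply: leq_sum => k _.
by rewrite lt0n; case: (f k) (h k).
Qed.

Lemma sum_colours (F : 'I_5 -> nat) : (forall k, 2 <= F k) -> 10 <= \sum_k F k.
Proof.
by move=> h; rewrite -[10]/(5 * 2) -{1}(card_ord 5) -sum_nat_const leq_sum.
Qed.

Lemma supp_size_mono (f g : 'I_5 -> nat) :
  (forall k, f k <= g k) -> supp_size f <= supp_size g.
Proof. by move=> h; apply: leq_sum => k _; have := h k; lia. Qed.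

Lemma sum_split (F G : 'I_5 -> nat) :
  \sum_k (F k + G k) = \sum_k F k + \sum_k G k.
Proof. exact: big_split. Qed.

Lemma sum_ge3 (f : 'I_5 -> nat) (a b d : 'I_5) :
  a != b -> d != a -> d != b -> f a + f b + f d <= \sum_k f k.
Proof.
move=> ab da db; have ba : b != a by rewrite eq_sym.
by rewrite (bigD1 a) //= (bigD1 b) //= (bigD1 d) /= ?da //; lia.
Qed.

Lemma sum_ge2 (f : 'I_5 -> nat) (a b : 'I_5) : b != a -> f a + f b <= \sum_k f k.
Proof.
by move=> ba; rewrite (bigD1 a) //= (bigD1 b) //= leq_add2l leq_addr.
Qed.

Lemma supp_size_ge3 (f : 'I_5 -> nat) (a b d : 'I_5) :
  a != b -> d != a -> d != b -> 0 < f a -> 0 < f b -> 0 < f d -> 3 <= supp_size f.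
Proof.
by move=> ab da db fa fb fd; have := sum_ge3 (fun k => 0 < f k : nat) ab da db; rewrite fa fb fd.
Qed.

Lemma sum_const5 (m : nat) : \sum_(k < 5) m = 5 * m.
Proof. by rewrite sum_nat_const card_ord. Qed.

Lemma eq_of_sum_le (F G : 'I_5 -> nat) :
  (forall k, F k <= G k) -> \sum_k G k <= \sum_k F k -> forall k, F k = G k.
Proof.
move=> h s k; apply/eqP; rewrite eqn_leq h leqNgt /=; apply/negP => lt.
move: s; rewrite leqNgt (bigD1 k) //= [X in _ < X](bigD1 k) //= => /negP; apply.
by rewrite -addSn leq_add // leq_sum.
Qed.

Lemma supp_size_all (f : 'I_5 -> nat) : (forall k, 0 < f k) -> supp_size f = 5.
Proof.
move=> h; rewrite /supp_size (eq_bigr (fun=> 1)) => [|k _]; last by rewrite h.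
by rewrite sum1_card card_ord.
Qed.

(** * Partial colourings *)

Section PartialColourings.

Variables (T : finType) (e : rel T).
Hypotheses (e_sym : symmetric e) (e_irr : irreflexive e).
Hypothesis deg5 : forall x, deg e x <= 5.

Local Notation pcol := (T -> option 'I_5).
Implicit Types (c : pcol) (u v w x y : T) (i j k l : 'I_5).

Definition upd c v o : pcol := fun x => if x == v then o else c x.

(** With [i = j] allowed, [good] covers the colour classes and the bichromatic subgraphs at once. *)
Definition pair_rel c i j : rel T := fun x y =>
  e x y && ((c x == Some i) && (c y == Some j)
            || (c x == Some j) && (c y == Some i)).

Definition good c : Prop := forall i j, acyclic (pair_rel c i j).

Definition holes c : nat := #|[set x | c x == None]|.

Definition num c v k : nat := #|[set u | e v u && (c u == Some k)]|.

Definition mult c v u k : nat :=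
  #|[set w | (e u w && (w != v)) && (c w == Some k)]|.

(** These are the vertices of colour [i] that can be the neighbours of [v] on a new cycle when [v]
    gets colour [k]; such a cycle needs two of them. *)
Definition cnt c v i k : nat :=
  #|[set u | (e v u && (c u == Some i)) && (0 < mult c v u k)]|.

Lemma edge_neq x y : e x y -> x != y.
Proof. by apply: contraTneq => ->; rewrite e_irr. Qed.

Lemma updE c v o : upd c v o v = o. Proof. by rewrite /upd eqxx. Qed.

Lemma updN c v o x : x != v -> upd c v o x = c x.
Proof. by rewrite /upd => /negbTE->. Qed.

Lemma pair_rel_step c i j x y z :
  pair_rel c i j x y -> pair_rel c i j y z -> c x = c z.
Proof.
rewrite /pair_rel => /andP[_ h1] /andP[_ h2].
by case/orP: h1 => /andP[/eqP h1 /eqP h1']; case/orP: h2 => /andP[/eqP h2 /eqP h2'];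
   congruence.
Qed.

Lemma pair_rel_edge c i j x y : pair_rel c i j x y -> e x y.
Proof. by case/andP. Qed.

Lemma pair_rel_some c i j x y : pair_rel c i j x y -> c x = Some i \/ c x = Some j.
Proof. by case/andP=> _ /orP[] /andP[/eqP-> _]; [left | right]. Qed.

(* Two neighbours of [v] on a new cycle have the same colour, and each of them
   is followed on the cycle by a vertex other than [v] that has the colour of [v]. *)
Lemma extend_good c v k :
  good c -> (forall i, cnt c v i k <= 1) -> good (upd c v (Some k)).
Proof.
move=> gc hv i j [s [sz /andP[cs us]]].
have [vs | vs] := boolP (v \in s); last first.
  apply: (gc i j); exists s; split=> //; apply/andP; split=> //.
  apply: (@sub_in_cycle _ [pred x | x != v] (pair_rel (upd c v (Some k)) i j)) cs.
    by move=> x y /= xv yv; rewrite /pair_rel !updN.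
  by apply/allP => x xs /=; apply: contraNneq vs => <-.
have [n s' rs] := rot_to vs.
move: cs us sz; rewrite -(rot_cycle n) -(rot_uniq n) -(size_rot n) rs.
case: s' {rs} => [|x s'] //; case/lastP: s' => [|r y] //.
rewrite (cycle_path v) /= last_rcons size_rcons => /and3P[yv vx pxy] un _.
(* [p] and [q] are the vertices on the cycle past [x] and [y]; in a triangle they are [y] and [x]
   themselves. *)
have [p [xp pv]] : exists p, pair_rel (upd c v (Some k)) i j x p /\ p != v.
  case: r pxy un => [|p r] /= /andP[xp _]; last first.
    by rewrite !inE => /andP[]; rewrite !negb_or => /and3P[_ h _]; exists p; rewrite eq_sym.
  by rewrite !inE => /andP[]; rewrite !negb_or => /andP[_ h]; exists y; rewrite eq_sym.
have [q [qy qv]] : exists q, pair_rel (upd c v (Some k)) i j q y /\ q != v.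
  move: pxy un; rewrite rcons_path => /andP[_ h] /andP[hv' _]; exists (last x r).
  split=> //; apply: contraNneq hv' => <-.
  by rewrite -rcons_cons mem_rcons inE mem_last orbT.
have xv : x != v by rewrite eq_sym (edge_neq (pair_rel_edge vx)).
have yv' : y != v by rewrite (edge_neq (pair_rel_edge yv)).
have xy : x != y.
  apply: contraTneq un => ->; rewrite /= mem_rcons inE eqxx /=.
  by rewrite andbF.
have cp : c p = Some k.
  by rewrite -(updN c (Some k) pv) -(pair_rel_step vx xp) updE.
have cq : c q = Some k.
  by rewrite -(updN c (Some k) qv) (pair_rel_step qy yv) updE.
have cxy : c x = c y.
  by rewrite -(updN c (Some k) xv) -(updN c (Some k) yv') (pair_rel_step yv vx).
have [i' cx] : exists i', c x = Some i'.
  rewrite -(updN c (Some k) xv).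
  by case: (pair_rel_some xp) => ->; [exists i | exists j].
have := hv i'; rewrite leqNgt => /negP; apply; apply/card_gt1P.
exists x, y; split=> //; rewrite !inE.
  rewrite (pair_rel_edge vx) cx eqxx /=; apply/card_gt0P; exists p.
  by rewrite inE (pair_rel_edge xp) pv cp eqxx.
rewrite e_sym (pair_rel_edge yv) -cxy cx eqxx /=; apply/card_gt0P; exists q.
by rewrite inE e_sym (pair_rel_edge qy) qv cq eqxx.
Qed.

Lemma erase_good c v : good c -> good (upd c v None).
Proof.
move=> gc i j [s [sz /andP[cs us]]]; apply: (gc i j); exists s; split=> //.
apply/andP; split=> //; apply: sub_cycle cs => x y; rewrite /pair_rel /upd.
by case: (x == v); case: (y == v); rewrite ?andbF ?orbF // !andbF.
Qed.

(** * Counting colours around a vertex and at distance two *)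

Lemma sum_classes c (P : pred T) :
  \sum_k #|[set w | P w && (c w == Some k)]| <= #|[set w | P w]|.
Proof.
have E (Q : pred T) : #|[set w | Q w]| = \sum_w Q w.
  by rewrite -sum1_card big_mkcond /=; apply: eq_bigr => w _; rewrite inE; case: (Q w).
under eq_bigr do rewrite E.
rewrite exchange_big E; apply: leq_sum => w _.
case: (P w) => /=; last by rewrite big1.
case cw: (c w) => [k|]; last by rewrite big1.
rewrite (bigD1 k) //= eqxx big1 // => k' kk'.
by case: eqP => // -[] kk; rewrite kk eqxx in kk'.
Qed.

Lemma sum_num c v : \sum_k num c v k <= 5.
Proof. exact: leq_trans (sum_classes _ _) (deg5 v). Qed.

Lemma sum_mult c v u : e v u -> \sum_k mult c v u k <= 4.
Proof.
move=> vu; apply: (leq_trans (sum_classes _ _)).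
have := deg5 u; rewrite /deg (cardsD1 v) inE e_sym vu add1n ltnS.
by apply: leq_trans; apply/subset_leq_card/subsetP => w; rewrite !inE andbC.
Qed.

Lemma cnt_num c v i k : cnt c v i k <= num c v i.
Proof. by apply/subset_leq_card/subsetP => w; rewrite !inE => /andP[]. Qed.

Lemma mult_hole c v u k : c v = None -> mult c v u k = num c u k.
Proof.
move=> cv; apply: eq_card => w; rewrite !inE; case: eqP => [->|]; last by rewrite andbT.
by rewrite cv !andbF.
Qed.

Lemma num_mult c v u i k : e u v -> c v = Some i ->
  num c u k = mult c v u k + (k == i).
Proof.
move=> uv cv; rewrite /num (cardsD1 v) inE uv cv addnC; congr (_ + _).
  by apply: eq_card => w; rewrite !inE andbCA andbA.
by congr nat_of_bool; rewrite /= eq_sym.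
Qed.

Lemma cnt_full c v u i k :
  num c v i <= cnt c v i k -> e v u -> c u = Some i -> 0 < mult c v u k.
Proof.
move=> h vu cu.
have S : [set u | (e v u && (c u == Some i)) && (0 < mult c v u k)]
         \subset [set u | e v u && (c u == Some i)].
  by apply/subsetP => w; rewrite !inE => /andP[].
have : u \in [set u | e v u && (c u == Some i)] by rewrite inE vu cu eqxx.
have /eqP <- : [set u | (e v u && (c u == Some i)) && (0 < mult c v u k)]
         == [set u | e v u && (c u == Some i)] by rewrite eqEcard S.
by rewrite inE => /andP[].
Qed.

Lemma num_gt0 c v u i : e v u -> c u = Some i -> 0 < num c v i.
Proof. by move=> vu cu; apply/card_gt0P; exists u; rewrite inE vu cu eqxx. Qed.

Lemma num_gt0P c v i : 0 < num c v i -> exists u, e v u /\ c u = Some i.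
Proof. by case/card_gt0P => u; rewrite inE => /andP[? /eqP]; exists u. Qed.

Lemma cnt_gt0P c v i k : 0 < cnt c v i k ->
  exists u, [/\ e v u, c u = Some i & 0 < mult c v u k].
Proof. by case/card_gt0P => u; rewrite inE => /andP[/andP[? /eqP]]; exists u. Qed.

Lemma cntE c v i k :
  cnt c v i k = \sum_(u | e v u && (c u == Some i)) (0 < mult c v u k).
Proof.
rewrite /cnt -sum1_card; rewrite big_mkcond [RHS]big_mkcond.
apply: eq_bigr => w _; rewrite inE.
by case: (e v w && (c w == Some i)) => //=; case: (0 < mult c v w k).
Qed.

Lemma sum_cnt c v i :
  \sum_k cnt c v i k = \sum_(u | e v u && (c u == Some i)) supp_size (mult c v u).
Proof. by under eq_bigr do rewrite cntE; rewrite exchange_big. Qed.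

Lemma sum_cnt_le c v i m :
  (forall u, e v u -> c u = Some i -> supp_size (mult c v u) <= m) ->
  \sum_k cnt c v i k <= num c v i * m.
Proof.
move=> h; rewrite sum_cnt /num -sum_nat_const.
under [X in _ <= X]eq_bigl do rewrite inE.
by apply: leq_sum => u /andP[vu /eqP]; apply: h.
Qed.

Lemma sum_cnt_gt c v i m : num c v i * m < \sum_k cnt c v i k ->
  exists u, [/\ e v u, c u = Some i & m < supp_size (mult c v u)].
Proof.
move=> h.
have /existsP[u /and3P[]] : [exists u, [&& e v u, c u == Some i & m < supp_size (mult c v u)]].
  apply: contraLR h; rewrite negb_exists -leqNgt => /forallP h.
  apply: sum_cnt_le => u vu cu; have := h u.
  by rewrite vu cu eqxx /= -leqNgt.
by move=> ? /eqP; exists u.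
Qed.

(** When the total is close to its maximum, this bounds the support at the single vertex [u] from
    below. *)
Lemma sum_cnt_rest c v u i m :
  e v u -> c u = Some i ->
  (forall u, e v u -> c u = Some i -> supp_size (mult c v u) <= m) ->
  \sum_k cnt c v i k + m <= num c v i * m + supp_size (mult c v u).
Proof.
move=> vu cu h; rewrite sum_cnt /num -sum_nat_const.
under [X in _ <= X + _]eq_bigl do rewrite inE.
have Pu : e v u && (c u == Some i) by rewrite vu cu eqxx.
rewrite (bigD1 u) //= [X in _ <= X + _](bigD1 u) //=.
have : \sum_(x | e v x && (c x == Some i) && (x != u)) supp_size (mult c v x)
  <= \sum_(x | e v x && (c x == Some i) && (x != u)) m.
  by apply: leq_sum => x /andP[/andP[vx /eqP cx] _]; apply: h.
lia.
Qed.


(** * Effect of recolouring and of moving the hole *)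

Lemma holes_colour c v k : c v = None -> (holes (upd c v (Some k))).+1 = holes c.
Proof.
move=> cv; rewrite [RHS](cardsD1 v) inE cv eqxx add1n; congr _.+1.
by apply: eq_card => w; rewrite !inE /upd; case: (w == v).
Qed.

Lemma holes_erase c v i : c v = Some i -> holes (upd c v None) = (holes c).+1.
Proof.
move=> cv; rewrite /holes (cardsD1 v) inE updE eqxx add1n; congr _.+1.
by apply: eq_card => w; rewrite !inE /upd; case: (w =P v) => // ->; rewrite cv.
Qed.

Lemma holes_recolour c v i k :
  c v = Some i -> holes (upd c v (Some k)) = holes c.
Proof.
move=> cv; apply: eq_card => w; rewrite !inE /upd.
by case: (w =P v) => // ->; rewrite cv.
Qed.

Lemma mult_upd c u v o j : mult (upd c u o) u v j = mult c u v j.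
Proof. by apply: eq_card => w; rewrite !inE /upd; case: (w == u); rewrite ?andbF. Qed.

Lemma mult_upd_self c v u o j : mult (upd c u o) v u j = mult c v u j.
Proof.
apply: eq_card => w; rewrite !inE /upd; case: (w =P u) => // ->.
by rewrite e_irr.
Qed.

Lemma mult_upd_le c v x u k j :
  j != k -> mult (upd c u (Some k)) v x j <= mult c v x j.
Proof.
move=> jk; apply/subset_leq_card/subsetP => w; rewrite !inE /upd.
case: (w == u) => // /andP[_] /eqP[kj]; by rewrite kj eqxx in jk.
Qed.

Lemma mult_upd_ge c v x u o i j :
  c u = Some i -> j != i -> mult c v x j <= mult (upd c u o) v x j.
Proof.
move=> cu ji; apply/subset_leq_card/subsetP => w; rewrite !inE /upd.
case: (w =P u) => // -> /andP[_]; rewrite cu => /eqP[ij]; by rewrite ij eqxx in ji.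
Qed.

Lemma num_recolour c v u i k j : e v u -> c u = Some i ->
  num (upd c u (Some k)) v j + (j == i) = num c v j + (j == k).
Proof.
move=> vu cu; rewrite (num_mult _ vu (updE c u (Some k))) (num_mult _ vu cu) mult_upd.
lia.
Qed.

(** The second move: the hole passes from [v] to its neighbour [u], and [v] gets colour [k]. *)
Definition shift c v u k : pcol := upd (upd c u None) v (Some k).

Lemma shiftN c v u k x : x != u -> x != v -> shift c v u k x = c x.
Proof. by move=> xu xv; rewrite /shift !updN. Qed.

Lemma num_shift c v u k j : e v u -> num (shift c v u k) u j = mult c v u j + (j == k).
Proof.
move=> vu; have uv : e u v by rewrite e_sym.
by rewrite (num_mult _ uv (updE _ v (Some k))) mult_upd mult_upd_self.
Qed.

Lemma mult_shift c v u i k j : e v u -> c u = Some i ->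
  mult (shift c v u k) u v j + (j == i) = num c v j.
Proof. by move=> vu cu; rewrite (num_mult _ vu cu) mult_upd_self mult_upd. Qed.

(** * Colourings with the least number of uncoloured vertices *)

Section Stuck.

Variable M : nat.
Hypothesis minimal : forall c, good c -> M <= holes c.

Definition config c v : Prop := [/\ good c, holes c = M & c v = None].

Lemma stuck c v k : config c v -> exists i, 1 < cnt c v i k.
Proof.
case=> gc hc cv; have /existsP[i hi] : [exists i, 1 < cnt c v i k]; last by exists i.
apply: contraT; rewrite negb_exists => /forallP h.
have : good (upd c v (Some k)).
  by apply: extend_good => // i; have := h i; rewrite -leqNgt.
by move/minimal; rewrite -hc -(holes_colour k cv) ltnn.
Qed.

Lemma config_recolour c v u i k : config c v -> c u = Some i ->
  (forall j, cnt c u j k <= 1) -> config (upd c u (Some k)) v.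
Proof.
case=> gc hc cv cu h; split; first exact: extend_good.
  by rewrite (holes_recolour _ cu).
by rewrite updN //; apply: contra_eq_neq cv => ->; rewrite cu.
Qed.

(** Uncolouring [u] takes it out of the vertices counted by [cnt c v i k]; this is why a count of
    two is harmless at colour [i]. *)
Lemma config_shift c v u i k : config c v -> e v u -> c u = Some i ->
  0 < mult c v u k -> cnt c v i k <= 2 ->
  (forall j, j != i -> cnt c v j k <= 1) -> config (shift c v u k) u.
Proof.
case=> gc hc cv vu cu mk ci cj; have uv := edge_neq vu.
split.
- apply: extend_good; first exact: erase_good.
  move=> j; pose A := [set w | (e v w && (c w == Some j)) && (0 < mult c v w k)].
  have S : cnt (upd c u None) v j k <= #|A :\ u|.
    apply/subset_leq_card/subsetP => w; rewrite !inE {1}/upd.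
    case: (w =P u) => [->|_]; first by rewrite andbF.
    move=> /andP[-> h] /=; apply: leq_trans h _.
    apply/subset_leq_card/subsetP => x; rewrite !inE /upd.
    by case: (x == u) => //; rewrite andbF.
  apply: leq_trans S _; rewrite {}/A; have [-> | ji] := eqVneq j i.
    move: ci; rewrite /cnt (cardsD1 u) inE vu cu eqxx mk /= add1n ltnS.
    by [].
  by apply: leq_trans (cj _ ji); apply/subset_leq_card/subsetP => w; rewrite !inE => /andP[].
- apply: succn_inj; rewrite /shift holes_colour ?(holes_erase cu) ?hc //.
  by rewrite updN.
- by rewrite /shift updN ?updE // eq_sym.
Qed.

Lemma config_free c v u i k : config c v -> e v u -> c u = Some i ->
  (forall j, mult c v u j <= 1) -> config (upd c u (Some k)) v.
Proof.
move=> cf vu cu h; apply: config_recolour (cu) _ => // j.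
apply: leq_trans (cnt_num _ _ _ _) _; rewrite -(mult_hole (v := v)) //.
by case: cf.
Qed.

Lemma free_of_supp4 c v u : e v u -> 3 < supp_size (mult c v u) ->
  forall j, mult c v u j <= 1.
Proof.
by move=> vu h j; have := supp_size_le (mult c v u) j; have := sum_mult c vu; lia.
Qed.

(** * The patterns (2,1,1,1) and (3,1,1) *)

Lemma stuck_in c v i : config c v -> (forall j, j != i -> num c v j <= 1) ->
  forall k, 1 < cnt c v i k.
Proof.
move=> cf h k; have [j cj] := stuck k cf; have [<- //|ji] := eqVneq j i.
by have := leq_trans cj (cnt_num _ _ _ _); rewrite ltnNge h.
Qed.

(** All five colours must be seen through two vertices of colour [i], which makes ten incidences,
    but each such vertex has at most four further neighbours. *)
Lemma no_pair c v i : config c v -> (forall j, j != i -> num c v j <= 1) ->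
  2 < num c v i.
Proof.
move=> cf h; rewrite ltnNge; apply/negP => n2.
have := sum_colours (stuck_in cf h).
have : \sum_k cnt c v i k <= num c v i * 4.
  apply: sum_cnt_le => u vu _; have := supp_size_le (mult c v u) i.
  by have := sum_mult c vu; lia.
lia.
Qed.

(** Ten incidences on three vertices give a vertex [u] that sees four distinct colours. Recolouring
    it with a colour absent around [v] leaves [i] as the only repeated colour, occurring twice. *)
Lemma no_triple c v i : config c v -> (forall j, j != i -> num c v j <= 1) ->
  3 < num c v i.
Proof.
move=> cf h; rewrite ltnNge; apply/negP => n3.
have n3' : num c v i = 3 by have := no_pair cf h; lia.
have [u [vu cu du]] : exists u, [/\ e v u, c u = Some i & 3 < supp_size (mult c v u)].
  by apply: sum_cnt_gt; have := sum_colours (stuck_in cf h); lia.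
have [k nk] : exists k, num c v k = 0.
  by apply: supp_size_lt5; have := supp_size_le (num c v) i; have := sum_num c v; lia.
have cf' := config_free k cf vu cu (free_of_supp4 vu du).
have ki : (i == k) = false by apply: contra_eqF n3' => /eqP->; rewrite nk.
have := @no_pair _ _ i cf'; have := num_recolour k i vu cu; rewrite eqxx ki => E H.
suff : 2 < num (upd c u (Some k)) v i by lia.
apply: H => j ji; have := num_recolour k j vu cu; rewrite (negbTE ji).
by have := h _ ji; case: (j =P k) => [->|_]; lia.
Qed.


(** * The pattern (2,2,1) *)

Lemma two_pairs_rest c v i j l : i != j -> num c v i = 2 -> num c v j = 2 ->
  l != i -> l != j -> num c v l <= 1.
Proof.
by move=> ij ni nj li lj; have := sum_ge3 (num c v) ij li lj; have := sum_num c v; lia.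
Qed.

(** Otherwise [u] could take a colour absent around [v], and only the pair of colour [j] would
    remain. *)
Lemma two_pairs_not_free c v u i j : config c v -> i != j ->
  num c v i = 2 -> num c v j = 2 -> e v u -> c u = Some i ->
  exists a, 1 < mult c v u a.
Proof.
move=> cf ij ni nj vu cu.
have /existsP[a ha] : [exists a, 1 < mult c v u a]; last by exists a.
apply: contraT; rewrite negb_exists => /forallP h.
have [k nk] : exists k, num c v k = 0.
  by apply: supp_size_lt5; have := supp_size_le2 (num c v) ij; have := sum_num c v; lia.
have cf' : config (upd c u (Some k)) v.
  by apply: config_free cf vu cu _ => l; have := h l; rewrite -leqNgt.
have jk : (j == k) = false by apply: contra_eqF nj => /eqP->; rewrite nk.
have := @no_pair _ _ j cf'; have := num_recolour k j vu cu.
rewrite eq_sym (negbTE ij) jk => E H.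
have ik : (i == k) = false by apply: contra_eqF ni => /eqP->; rewrite nk.
suff : 2 < num (upd c u (Some k)) v j by lia.
apply: H => l lj; have := num_recolour k l vu cu.
have [->|li] := eqVneq l i; first by rewrite ni ik; lia.
have := two_pairs_rest ij ni nj li lj.
by case: (l =P k) => [->|_]; lia.
Qed.

Lemma two_pairs_cover c v i j k : config c v -> i != j ->
  num c v i = 2 -> num c v j = 2 -> (1 < cnt c v i k) || (1 < cnt c v j k).
Proof.
move=> cf ij ni nj; have [l cl] := stuck k cf.
have := leq_trans cl (cnt_num c v l k).
have [<-|li] := eqVneq l i; first by rewrite cl.
have [<-|lj] := eqVneq l j; first by rewrite cl orbT.
by have := two_pairs_rest ij ni nj li lj; lia.
Qed.

(** [u] sees at least three colours and one of them twice; this exhausts its four further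
    neighbours, so all estimates are equalities. *)
Lemma two_pairs_half c v u i j : config c v -> i != j ->
  num c v i = 2 -> num c v j = 2 -> e v u -> c u = Some i ->
  3 <= \sum_k (1 < cnt c v i k) ->
  exists a, [/\ mult c v u a = 2, forall k, k != a -> mult c v u k <= 1,
    1 < cnt c v j a, \sum_k (1 < cnt c v i k) = 3
    & forall k, (1 < cnt c v i k) = (0 < mult c v u k)].
Proof.
move=> cf ij ni nj vu cu sA.
have [a ha] := two_pairs_not_free cf ij ni nj vu cu.
have Ale k : (1 < cnt c v i k) <= (0 < mult c v u k).
  case: ltnP => // ck; rewrite (cnt_full _ vu cu) // ni; exact: ck.
have sAle : \sum_k (1 < cnt c v i k) <= supp_size (mult c v u) by apply: leq_sum.
have := supp_size_le (mult c v u) a; have := sum_mult c vu => sm sa.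
have ma : mult c v u a = 2 by lia.
have mk k : k != a -> mult c v u k <= 1.
  by rewrite eq_sym => ak; have := supp_size_le2 (mult c v u) ak; lia.
exists a; split=> //; last 2 first.
- by lia.
- have sle : \sum_k (0 < mult c v u k) <= \sum_k (1 < cnt c v i k).
    by rewrite -/(supp_size _); lia.
  by move=> k; have := eq_of_sum_le Ale sle k; case: (1 < _); case: (0 < _).
rewrite ltnNge; apply/negP => cja.
have cf' : config (shift c v u a) u.
  apply: config_shift cf vu cu _ _ _; first by rewrite ma.
    by rewrite -ni cnt_num.
  move=> l li; have [-> //|lj] := eqVneq l j.
  by apply: leq_trans (cnt_num _ _ _ _) (two_pairs_rest ij ni nj li lj).
have := @no_triple _ _ a cf'; rewrite num_shift // ma eqxx => H.
suff : 3 < 2 + true by [].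
apply: H => l la; rewrite num_shift // (negbTE la) addn0; exact: mk.
Qed.

(* The colours seen at distance two through [u] cover three colours, those through
   [w] cover three, and together they cover all five; the colour [a] seen twice
   lies in both triples, since otherwise shifting the hole to [u] (or [w]) and
   colouring [v] with [a] produces the pattern (3,1,1). *)
Lemma two_pairs c v u w i j : config c v -> i != j ->
  num c v i = 2 -> num c v j = 2 ->
  e v u -> c u = Some i -> e v w -> c w = Some j ->
  exists a, [/\ mult c v u a = 2, mult c v w a = 2
    & forall k, k != a -> mult c v u k + mult c v w k = 1].
Proof.
move=> cf ij ni nj vu cu vw cw; have ji : j != i by rewrite eq_sym.
pose h k := (1 < cnt c v i k) + (1 < cnt c v j k).
have h1 k : 0 < h k.
  by rewrite /h; have := two_pairs_cover k cf ij ni nj; lia.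
have h5 := supp_size_all h1.
have sh : \sum_k h k = \sum_k (1 < cnt c v i k) + \sum_k (1 < cnt c v j k).
  exact: sum_split.
(* Since [h] is at least 1 everywhere, one side covers three colours. Its doubled colour then has
   [h] equal to 2, the sum is at least 6, and the other side covers three as well. *)
have big : 3 <= \sum_k (1 < cnt c v i k) /\ 3 <= \sum_k (1 < cnt c v j k).
  have [s|s] := leqP 3 (\sum_k (1 < cnt c v i k)).
    have [a [ma _ Ba sA Aa]] := two_pairs_half cf ij ni nj vu cu s.
    by have := supp_size_le h a; rewrite {2}/h Ba Aa ma; lia.
  have s' : 3 <= \sum_k (1 < cnt c v j k) by have := supp_size_le h i; lia.
  have [a [ma _ Ba sA Aa]] := two_pairs_half cf ji nj ni vw cw s'.
  by have := supp_size_le h a; rewrite {2}/h Ba Aa ma; lia.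
have [a [ma ma1 Ba sA Aa]] := two_pairs_half cf ij ni nj vu cu big.1.
have [b [mb mb1 Ab sB Bb]] := two_pairs_half cf ji nj ni vw cw big.2.
have ha : h a = 2 by rewrite /h Ba Aa ma.
have hb : h b = 2 by rewrite /h Ab Bb mb.
(* The sum of [h] is exactly 6, which leaves room for only one colour of value 2. *)
have ab : a = b.
  by apply/eqP; apply: contraT => ab; have := supp_size_le2 h ab; lia.
rewrite -ab in mb mb1; exists a; split=> // k ka; have ak : a != k by rewrite eq_sym.
have := ma1 _ ka; have := mb1 _ ka; have := supp_size_le2 h ak; have := h1 k.
have : h k = (0 < mult c v u k) + (0 < mult c v w k) by rewrite /h Aa Bb.
lia.
Qed.

(* Shifting the hole to [u] gives again the pattern (2,2,1); [two_pairs] there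
   shows that the two neighbours of [u] of equal colour do not see the colour [l]. *)
Lemma two_pairs_third c v u w i j : config c v -> i != j ->
  num c v i = 2 -> num c v j = 2 ->
  e v u -> c u = Some i -> e v w -> c w = Some j ->
  (exists l, [/\ l != i, l != j & num c v l = 1]) /\
  (forall l, l != i -> l != j -> num c v l = 1 -> config (upd c u (Some l)) v).
Proof.
move=> cf ij ni nj vu cu vw cw.
have [a [ma mwa mk]] := two_pairs cf ij ni nj vu cu vw cw.
have s8 : \sum_k (mult c v u k + mult c v w k) = 8.
  rewrite (bigD1 a) //= ma mwa (eq_bigr (fun=> 1)) => [|k]; last exact: mk.
  by rewrite sum1_card cardC1 card_ord.
have su := sum_mult c vu; have sw := sum_mult c vw; rewrite sum_split in s8.
have [b [ba mb]] : exists b, b != a /\ mult c v u b = 1.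
  have /existsP[b /andP[ba hb]] : [exists b, (b != a) && (0 < mult c v u b)].
    apply: contraT; rewrite negb_exists => /forallP h.
    have : \sum_k mult c v u k = 2.
      rewrite (bigD1 a) //= ma big1 // => k ka.
      by have := h k; rewrite ka /= -leqNgt leqn0 => /eqP.
    by move: su sw s8; clear; lia.
  by exists b; split=> //; move: (mk _ ba) hb; clear; lia.
(* [b] is seen by [u], hence not by [w], so colour [j] does not block it. *)
have cf' : config (shift c v u b) u.
  apply: config_shift cf vu cu _ _ _; first by rewrite mb.
    by rewrite -ni cnt_num.
  move=> l li; have [->|lj] := eqVneq l j; last first.
    by apply: leq_trans (cnt_num _ _ _ _) (two_pairs_rest ij ni nj li lj).
  rewrite leqNgt; apply/negP => cj; have := mk _ ba.
  by have := @cnt_full c v w j b; rewrite nj => /(_ cj vw cw); move: mb; clear; lia.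
have uv : e u v by rewrite e_sym.
have nb' : num (shift c v u b) u b = 2 by rewrite num_shift // eqxx mb.
have na' : num (shift c v u b) u a = 2.
  by rewrite num_shift // eq_sym (negbTE ba) ma.
have cv' : shift c v u b v = Some b by rewrite /shift updE.
have ab : a != b by rewrite eq_sym.
have key y : e u y -> shift c v u b y = Some a ->
    mult (shift c v u b) u v j = 2 /\
    forall k, k != j -> mult (shift c v u b) u v k + mult (shift c v u b) u y k = 1.
  move=> uy cy; have [d [md myd hd]] := two_pairs cf' ba nb' na' uv cv' uy cy.
  (* Only [i] and [j] occur twice around [v], and one vertex of colour [i], namely [u], is now the
     hole. *)
  have dj : d = j.
    apply/eqP; apply: contraT => dj; have := mult_shift b d vu cu.
    rewrite md; have [->|di] := eqVneq d i; first by rewrite ni.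
    by have := two_pairs_rest ij ni nj di dj; clear; lia.
  by rewrite -dj.
have [y [uy cy]] : exists y, e u y /\ shift c v u b y = Some a.
  by apply: num_gt0P; rewrite na'.
have vj := (key _ uy cy).1; split.
  (* From the new hole, [v] and [y] see 8 coloured vertices together, so [v] sees four. Three of
     them have colour [i] or [j]; the fourth provides [l]. *)
  have /existsP[l /and3P[li lj nl]] : [exists l, [&& l != i, l != j & num c v l == 1]].
    2: by exists l; split=> //; apply/eqP.
  apply: contraT; rewrite negb_exists => /forallP h.
  have s4 : \sum_k (mult (shift c v u b) u v k + mult (shift c v u b) u y k) = 8.
    have [_ hk] := key _ uy cy.
    have [d [md myd hd]] := two_pairs cf' ba nb' na' uv cv' uy cy.
    rewrite (bigD1 d) //= md myd (eq_bigr (fun=> 1)) => [|k]; last exact: hd.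
    by rewrite sum1_card cardC1 card_ord.
  have := sum_mult (shift c v u b) uv; have := sum_mult (shift c v u b) uy.
  rewrite sum_split in s4; move=> sy sv.
  have : \sum_k mult (shift c v u b) u v k <= 3.
    rewrite (bigD1 i) //= (bigD1 j) 1?eq_sym //= vj big1.
      by have := mult_shift b i vu cu; rewrite ni eqxx; clear; lia.
    move=> k /andP[ki kj]; have := mult_shift b k vu cu; have := h k.
    rewrite (negbTE ki) (negbTE kj) /= addn0 => nk1 ->.
    by have := two_pairs_rest ij ni nj ki kj; case: (num c v k) nk1 => [|[]].
  by move: s4 sy; clear; lia.
have cv : c v = None by case: cf.
move=> l li lj nl; apply: config_recolour cf (cu) _ => d.
have [->|da] := eqVneq d a; last first.
  apply: leq_trans (cnt_num _ _ _ _) _; rewrite -(mult_hole (v := v)) //.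
  by have := mk _ da; clear; lia.
rewrite leqNgt; apply/negP => /ltnW /cnt_gt0P[x [ux cx mx]].
have xv : x != v by apply: contra_eq_neq cv => <-; rewrite cx.
have xu : x != u by rewrite eq_sym (edge_neq ux).
have [|_ /(_ l lj)] := key _ ux; first by rewrite shiftN.
have := mult_shift b l vu cu; rewrite nl (negbTE li) addn0 => ->.
suff : mult c u x l <= mult (shift c v u b) u x l by move: mx; clear; lia.
apply/subset_leq_card/subsetP => z; rewrite !inE => /andP[/andP[-> zu] cz].
rewrite zu shiftN //; apply: contraTneq cz => ->; by rewrite cv.
Qed.

(* After recolouring [u] (resp. [w]) with [l], the neighbour [x] of colour [l] must
   see the same colours as [u] (resp. [w]), yet the two recolourings change what [x]
   sees only at the colours [i], [j], [l]. *)
Lemma no_two_pairs c v i j : config c v -> i != j ->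
  num c v i = 2 -> num c v j = 2 -> False.
Proof.
move=> cf ij ni nj; have ji : j != i by rewrite eq_sym.
have [u [vu cu]] : exists u, e v u /\ c u = Some i by apply: num_gt0P; rewrite ni.
have [w [vw cw]] : exists w, e v w /\ c w = Some j by apply: num_gt0P; rewrite nj.
have [[l [li lj nl]] cfu] := two_pairs_third cf ij ni nj vu cu vw cw.
have [_ cfw] := two_pairs_third cf ji nj ni vw cw vu cu.
have [x [vx cx]] : exists x, e v x /\ c x = Some l by apply: num_gt0P; rewrite nl.
have {}cfu := cfu _ li lj nl; have {}cfw := cfw _ lj li nl.
have [a [ma mwa mk]] := two_pairs cf ij ni nj vu cu vw cw.
(* Once [p] has colour [l], it forms a pair with [x], and both are tied to [q] by the same
   complementarity. *)
have side c1 p q i1 j1 : config (upd c p (Some l)) v -> i1 != j1 ->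
    num c v i1 = 2 -> num c v j1 = 2 -> l != i1 -> l != j1 ->
    e v p -> c p = Some i1 -> e v q -> c q = Some j1 -> c1 = upd c p (Some l) ->
    forall k, mult c1 v x k = mult c v p k.
  move=> cf1 ij1 ni1 nj1 li1 lj1 vp cp vq cq c1E.
  have n1 : num c1 v l = 2.
    have := num_recolour l l vp cp; rewrite -c1E eqxx (negbTE li1) nl; clear; lia.
  have n2 : num c1 v j1 = 2.
    have := num_recolour l j1 vp cp; rewrite -c1E nj1 eq_sym (negbTE ij1).
    by rewrite eq_sym (negbTE lj1); clear; lia.
  have c1q : c1 q = Some j1.
    rewrite c1E updN //; apply: contra_neq ij1 => qp.
    by move: cq; rewrite qp cp => -[].
  have c1x : c1 x = Some l.
    rewrite c1E updN //; apply: contra_neq li1 => xp.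
    by move: cx; rewrite xp cp => -[].
  have c1p : c1 p = Some l by rewrite c1E updE.
  rewrite -c1E in cf1.
  have [b [pb qb hb]] := two_pairs cf1 lj1 n1 n2 vp c1p vq c1q.
  have [d [xd qd hd]] := two_pairs cf1 lj1 n1 n2 vx c1x vq c1q.
  have bd : b = d.
    by apply/eqP; apply: contraT => bd; have := hd _ bd; move: pb qb; clear; lia.
  rewrite -{}bd in xd qd hd; move=> k.
  have -> : mult c v p k = mult c1 v p k by rewrite c1E mult_upd_self.
  have [->|kb] := eqVneq k b; first by rewrite xd pb.
  by have := hb _ kb; have := hd _ kb; clear; lia.
have xu := side _ _ _ _ _ cfu ij ni nj li lj vu cu vw cw erefl.
have xw := side _ _ _ _ _ cfw ji nj ni lj li vw cw vu cu erefl.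
(* At such a colour neither recolouring changes what [x] sees, so [u] and [w] see it equally often;
   but these two numbers add up to 1. *)
have [k /and4P[ka kl ki kj]] : exists k, [&& k != a, k != l, k != i & k != j].
  have /existsP[k hk] : [exists k, k \notin [:: a; l; i; j]].
    apply: contraT; rewrite negb_exists => /forallP h.
    have : #|'I_5| <= size [:: a; l; i; j].
      apply: leq_trans (card_size _); apply/subset_leq_card/subsetP => k _.
      by have := h k; rewrite negbK.
    by rewrite card_ord.
  by exists k; rewrite !inE !negb_or in hk.
have := mult_upd_le c v x u kl; have := mult_upd_ge v x (Some l) cu ki.
have := mult_upd_le c v x w kl; have := mult_upd_ge v x (Some l) cw kj.
by rewrite xu xw; have := mk _ ka; clear; lia.
Qed.

(** * Reduction to two colours, and the pattern (4,1) *)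

Lemma some_triple c v : config c v -> exists i, 2 < num c v i.
Proof.
move=> cf; have /existsP[i hi] : [exists i, 2 < num c v i]; last by exists i.
apply: contraT; rewrite negb_exists => /forallP le2.
have le1 i : exists2 j, j != i & num c v j = 2.
  have /existsP[j /andP[ji /eqP nj]] : [exists j, (j != i) && (num c v j == 2)].
    apply: contraT; rewrite negb_exists => /forallP h'.
    have : 2 < num c v i; last by have := le2 i; lia.
    apply: no_pair cf _ => j ji; have := h' j; have := le2 j; rewrite ji; lia.
  by exists j.
have [i _ ni] := le1 ord0; have [j ji nj] := le1 i.
by case: (no_two_pairs cf ji nj ni).
Qed.

Lemma supp_size_num_le2 c v : config c v -> supp_size (num c v) <= 2.
Proof.
move=> cf; rewrite leqNgt; apply/negP => h; have [i ni] := some_triple cf.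
have sm := sum_num c v; have := supp_size_le (num c v) i => si.
have : 3 < num c v i; last by lia.
apply: no_triple cf _ => j ji; rewrite eq_sym in ji.
by have := supp_size_le2 (num c v) ji; lia.
Qed.

(** If the hole can move to [u], the colours seen by [u] all occur around the new hole. *)
Lemma supp_size_shift c v u i k : config c v -> e v u -> c u = Some i ->
  0 < mult c v u k -> cnt c v i k <= 2 ->
  (forall j, j != i -> cnt c v j k <= 1) -> supp_size (mult c v u) <= 2.
Proof.
move=> cf vu cu mk ci cj.
apply: leq_trans (supp_size_num_le2 (config_shift cf vu cu mk ci cj)).
by apply: supp_size_mono => j; rewrite num_shift // leq_addr.
Qed.

(** No vertex of colour [i] sees four colours, since recolouring it would leave a triple without
    another repetition. Some [u] sees three, and the hole cannot move there, so these three colours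
    are each seen through three vertices: at least 13 incidences against at most 12. *)
Lemma no_four c v i : config c v -> num c v i = 4 -> False.
Proof.
move=> cf ni; have sm := sum_num c v.
have rest j : j != i -> num c v j <= 1.
  by move=> ji; have := sum_ge2 (num c v) ji; lia.
have cnt2 := stuck_in cf rest.
have locked u : e v u -> c u = Some i -> supp_size (mult c v u) <= 3.
  move=> vu cu; rewrite leqNgt; apply/negP => du.
  have [k nk] : exists k, num c v k = 0.
    by apply: supp_size_lt5; have := supp_size_le (num c v) i; lia.
  have cf' := config_free k cf vu cu (free_of_supp4 vu du).
  have ik : (i == k) = false by apply: contra_eqF ni => /eqP->; rewrite nk.
  have := @no_triple _ _ i cf'; have := num_recolour k i vu cu; rewrite eqxx ik => E H.
  suff : 3 < num (upd c u (Some k)) v i by lia.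
  apply: H => j ji; have := num_recolour k j vu cu; rewrite (negbTE ji).
  by have := rest _ ji; have [->|_] := eqVneq j k; lia.
have [u [vu cu du]] : exists u, [/\ e v u, c u = Some i & 2 < supp_size (mult c v u)].
  by apply: sum_cnt_gt; have := sum_colours cnt2; lia.
have /existsP[k /andP[mk ck]] : [exists k, (0 < mult c v u k) && (cnt c v i k <= 2)].
  apply: contraT; rewrite negb_exists => /forallP h.
  have : \sum_k (2 + (0 < mult c v u k)) <= \sum_k cnt c v i k.
    apply: leq_sum => k _; have := h k; have := cnt2 k.
    by case: (0 < mult c v u k) => /=; clear; lia.
  rewrite sum_split sum_const5 -/(supp_size _).
  by have := sum_cnt_le locked; lia.
have := supp_size_shift cf vu cu mk ck; rewrite leqNgt du => H.
suff : false by []. apply: H => j ji.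
exact: leq_trans (cnt_num _ _ _ _) (rest _ ji).
Qed.

(** * The pattern (3,2) *)

Lemma triple_pair c v i : config c v -> num c v i = 3 ->
  exists2 j, i != j & num c v j = 2.
Proof.
move=> cf ni.
have /existsP[j /andP[ji nj]] : [exists j, (j != i) && (1 < num c v j)].
  apply: contraT; rewrite negb_exists => /forallP h'.
  have : 3 < num c v i; last by rewrite ni.
  by apply: no_triple cf _ => j ji; have := h' j; rewrite ji -leqNgt.
exists j; first by rewrite eq_sym.
by have := sum_ge2 (num c v) ji; have := sum_num c v; lia.
Qed.

Lemma triple_pair_rest c v i j l : i != j -> num c v i = 3 -> num c v j = 2 ->
  l != i -> l != j -> num c v l = 0.
Proof.
by move=> ij ni nj li lj; have := sum_ge3 (num c v) ij li lj; have := sum_num c v; lia.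
Qed.

(** Recolouring [u] with an absent colour would keep [i] and [j] and bring a third colour around
    [v]. *)
Lemma triple_not_free c v i j m u : config c v -> i != j ->
  num c v i = 3 -> num c v j = 2 -> e v u -> c u = Some m ->
  exists a, 1 < mult c v u a.
Proof.
move=> cf ij ni nj vu cu.
have /existsP[a ha] : [exists a, 1 < mult c v u a]; last by exists a.
apply: contraT; rewrite negb_exists => /forallP h.
have [k nk] : exists k, num c v k = 0.
  by apply: supp_size_lt5; have := supp_size_num_le2 cf; clear; lia.
have cf' : config (upd c u (Some k)) v.
  by apply: config_free cf vu cu _ => l; have := h l; rewrite -leqNgt.
have ki : k != i by apply: contra_eq_neq ni => <-; rewrite nk.
have kj : k != j by apply: contra_eq_neq nj => <-; rewrite nk.
have := supp_size_num_le2 cf'; rewrite leqNgt => /negP[].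
have N l := num_recolour k l vu cu.
apply: (supp_size_ge3 ij ki kj).
- by have := N i; rewrite ni; clear; lia.
- by have := N j; rewrite nj; clear; lia.
- have := N k; rewrite nk eqxx.
  have -> : (k == m) = false; last by clear; lia.
  by apply: contraTF (num_gt0 vu cu) => /eqP <-; rewrite nk.
Qed.

(* [t = 3]: all neighbours of colour [i] see the same three colours. [t = 2]: they
   see the three pairs out of three colours. Either way the two neighbours of
   colour [j] see exactly the two complementary colours. *)
Lemma triple_structure c v i j : config c v -> i != j ->
  num c v i = 3 -> num c v j = 2 ->
  [/\ exists2 t, 2 <= t & (forall k, cnt c v i k + t * (1 < cnt c v j k) = t) /\
        (forall u, e v u -> c u = Some i -> supp_size (mult c v u) = t),
      \sum_k (1 < cnt c v j k) = 2
    & forall w, e v w -> c w = Some j -> supp_size (mult c v w) <= 2].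
Proof.
move=> cf ij ni nj; pose B k := 1 < cnt c v j k.
have le3 m u : e v u -> c u = Some m -> supp_size (mult c v u) <= 3.
  move=> vu cu; have [a ha] := triple_not_free cf ij ni nj vu cu.
  by have := supp_size_le (mult c v u) a; have := sum_mult c vu; move: ha; clear; lia.
have cntj k : cnt c v j k <= 2 by rewrite -nj cnt_num.
have cntl k l : l != i -> l != j -> cnt c v l k <= 1.
  by move=> li lj; apply: leq_trans (cnt_num _ _ _ _) _; rewrite (triple_pair_rest ij ni nj).
have cover k : ~~ B k -> 1 < cnt c v i k.
  move=> Bk; have [l cl] := stuck k cf; have [<- //|li] := eqVneq l i.
  have [lj|lj] := eqVneq l j; first by rewrite lj -/(B k) (negbTE Bk) in cl.
  by move: cl; rewrite ltnNge cntl.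
have s9 : \sum_k cnt c v i k <= 3 * 3.
  by rewrite -[X in _ <= X * _]ni; apply: sum_cnt_le => u; apply: le3.
(* Nine incidences cannot serve all five colours twice, so some [k] is blocked only through [j], and
   the hole can move to [w]. *)
have supp_w w : e v w -> c w = Some j -> supp_size (mult c v w) <= 2.
  move=> vw cw.
  have /existsP[k] : [exists k, ~~ (1 < cnt c v i k)].
    apply: contraT; rewrite negb_exists => /forallP h.
    have := @sum_colours (cnt c v i); rewrite leqNgt (leq_ltn_trans s9) // => H.
    suff : false by []. by apply: H => k; have := h k; rewrite negbK.
  rewrite -leqNgt => ck; have Bk : B k.
    by apply: contraTT ck => /cover; rewrite ltnNge.
  apply: (supp_size_shift cf vw cw _ (cntj k)).
    by apply: cnt_full vw cw; rewrite nj.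
  by move=> l lj; have [->//|li] := eqVneq l i; apply: cntl.
have B2 : \sum_k B k <= 2.
  have [w [vw cw]] : exists w, e v w /\ c w = Some j by apply: num_gt0P; rewrite nj.
  apply: leq_trans (supp_w _ vw cw); apply: leq_sum => k _.
  by case Bk: (B k) => //; rewrite (cnt_full _ vw cw) // nj.
(* The sum over all colours is at least [5 * t], while three vertices of support [t] and two colours
   in [B] give at most [3 * t + 2 * t]; everything is therefore an equality. *)
suff [t [t2 ht st]] : exists t, [/\ 2 <= t, forall k, t <= cnt c v i k + t * B k
    & forall u, e v u -> c u = Some i -> supp_size (mult c v u) <= t].
  have sC : \sum_k cnt c v i k <= 3 * t.
    by rewrite -[X in _ <= X * _]ni; apply: sum_cnt_le.
  have sB : \sum_k (cnt c v i k + t * B k) = \sum_k cnt c v i k + t * \sum_k B k.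
    by rewrite sum_split big_distrr.
  have s5 : 5 * t <= \sum_k (cnt c v i k + t * B k).
    by rewrite -sum_const5; apply: leq_sum => k _; apply: ht.
  have B2' : \sum_k B k = 2.
    apply/eqP; rewrite eqn_leq B2 leqNgt /=; apply/negP => B1.
    have : t * \sum_k B k <= t * 1 by rewrite leq_mul2l -ltnS B1 orbT.
    by move: sC sB s5 t2; clear; lia.
  rewrite B2' in sB; split=> //; exists t => //; split=> [k|u vu cu].
    apply/esym; apply: (@eq_of_sum_le (fun=> t)) ht _ k.
    by rewrite sum_const5 sB; move: sC; clear; lia.
  have := sum_cnt_rest vu cu st; rewrite ni; have := st _ vu cu.
  by move: sB s5; clear; lia.
have [/existsP[u0 /and3P[vu0 /eqP cu0 d0]]|] :=
    boolP [exists u, [&& e v u, c u == Some i & 2 < supp_size (mult c v u)]].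
  (* A vertex seeing three colours cannot receive the hole, so what it sees outside [B] is seen by
     the whole triple. *)
  have three u k : e v u -> c u = Some i -> 2 < supp_size (mult c v u) ->
      ~~ B k -> 0 < mult c v u k -> 2 < cnt c v i k.
    move=> vu cu du Bk mk; rewrite ltnNge; apply/negP => ck.
    have := supp_size_shift cf vu cu mk ck; rewrite leqNgt du => H.
    suff : false by []. apply: H => l li.
    by have [->|lj] := eqVneq l j; [rewrite leqNgt | apply: cntl].
  have s13 : 13 <= \sum_k cnt c v i k + 2 * \sum_k B k.
    have : \sum_k (2 + (0 < mult c v u0 k)) <= \sum_k (cnt c v i k + 2 * B k).
      apply: leq_sum => k _; have := @three u0 k vu0 cu0 d0; have := cover k.
      case: (B k) => /=; last by case: (0 < _) => [_ /(_ isT isT)|/(_ isT)]; clear; lia.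
      case mk: (0 < mult c v u0 k) => _ _; last by clear; lia.
      have : 0 < cnt c v i k; last by clear; lia.
      by apply/card_gt0P; exists u0; rewrite inE vu0 cu0 eqxx mk.
    have -> : 2 * \sum_k B k = \sum_k 2 * B k by rewrite big_distrr.
    rewrite !sum_split sum_const5 -/(supp_size _).
    by move: d0; clear; lia.
  exists 3; split=> // [k|u]; last exact: le3.
  have := cover k; case Bk: (B k) => /=; first by clear; lia.
  move=> /(_ isT) ck; rewrite addn0.
  have [u [vu cu mk]] := cnt_gt0P (ltnW ck).
  apply: three (vu) (cu) _ _ mk; last by rewrite Bk.
  have := sum_cnt_rest vu cu (@le3 i); rewrite ni.
  by move: s13 B2; clear; lia.
rewrite negb_exists => /forallP h; exists 2; split=> // [k|u vu cu].
  by have := cover k; case: (B k) => /=; [|move/(_ isT)]; clear; lia.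
by have := h u; rewrite vu cu eqxx /= -leqNgt.
Qed.

(** A colour [k] seen three times leaves room for one other colour, so [t = 2] and the hole can move
    to [u]; with [v] coloured [k], four vertices around [u] have that colour. *)
Lemma triple_mult_le2 c v u i k : config c v -> num c v i = 3 ->
  e v u -> c u = Some i -> mult c v u k <= 2.
Proof.
move=> cf ni vu cu; have [j ij nj] := triple_pair cf ni.
have [[t t2 [ht st]] _ _] := triple_structure cf ij ni nj.
rewrite leqNgt; apply/negP => mk.
have := supp_size_le (mult c v u) k; have := sum_mult c vu; rewrite (st _ vu cu) => sm sk.
have t2' : t = 2 by lia.
have m3 : mult c v u k = 3 by lia.
have ck : 0 < cnt c v i k.
  by apply/card_gt0P; exists u; rewrite inE vu cu eqxx m3.
have := ht k; rewrite t2' => hk.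
have cf' : config (shift c v u k) u.
  apply: config_shift (cf) (vu) (cu) _ _ _; first by rewrite m3.
    by move: hk; clear; lia.
  move=> l li; have [->|lj] := eqVneq l j; first by move: hk ck; clear; lia.
  by apply: leq_trans (cnt_num _ _ _ _) _; rewrite (triple_pair_rest ij ni nj).
by apply: (@no_four _ _ k cf'); rewrite num_shift // m3 eqxx.
Qed.

(* With the hole shifted to [w], [v] lies in the new triple and sees the colour [i]
   three times, against [triple_mult_le2]. *)
Lemma no_three c v i : config c v -> num c v i = 3 -> False.
Proof.
move=> cf ni; have [j ij nj] := triple_pair cf ni.
have [[t t2 [ht st]] sB sw] := triple_structure cf ij ni nj.
have [w [vw cw]] : exists w, e v w /\ c w = Some j by apply: num_gt0P; rewrite nj.
have Ble k : (1 < cnt c v j k) <= (0 < mult c v w k).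
  by case Bk: (1 < cnt c v j k) => //; rewrite (cnt_full _ vw cw) // nj.
have sup2 : supp_size (mult c v w) = 2.
  by apply/eqP; rewrite eqn_leq sw //= -sB; apply: leq_sum => k _.
have [a ha] := triple_not_free cf ij ni nj vw cw.
have Ba : 1 < cnt c v j a.
  have : (1 < cnt c v j a : nat) = (0 < mult c v w a).
    by apply: (eq_of_sum_le Ble); rewrite sB (leq_trans _ (eq_leq sup2)).
  by rewrite (ltnW ha); case: (1 < _).
(* A colour blocked through [j] is not seen through [i] at all, which frees [a] for [v]. *)
have ca : cnt c v i a = 0 by have := ht a; rewrite Ba; clear; lia.
have cf' : config (shift c v w a) w.
  apply: config_shift (cf) (vw) (cw) (ltnW ha) _ _; first by rewrite -nj cnt_num.
  move=> l lj; have [->|li] := eqVneq l i; first by rewrite ca.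
  by apply: leq_trans (cnt_num _ _ _ _) _; rewrite (triple_pair_rest ij ni nj).
have na : num (shift c v w a) w a = mult c v w a + 1 by rewrite num_shift // eqxx.
have := supp_size_le (mult c v w) a; have := sum_mult c vw; rewrite sup2 => sm sa.
have [m3|m3] := eqVneq (mult c v w a) 3.
  by apply: (@no_four _ _ a cf'); rewrite na m3.
have wv : e w v by rewrite e_sym.
have sv : shift c v w a v = Some a by rewrite /shift updE.
have n3 : num (shift c v w a) w a = 3 by rewrite na; move: ha m3 sm sa; clear; lia.
have := triple_mult_le2 i cf' n3 wv sv; have := mult_shift a i vw cw.
by rewrite ni (negbTE ij) addn0 => ->.
Qed.

(** * The pattern (5) *)

Lemma monochromatic_neighbours c v : config c v -> exists i, num c v i = 5.
Proof.
move=> cf; have [i ni] := some_triple cf; exists i.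
have := sum_ge2 (num c v) (_ : (if i == ord0 then ord_max else ord0) != i).
have -> : (if i == ord0 then ord_max else ord0) != i.
  by have [->|] := eqVneq i ord0; rewrite // eq_sym.
move=> /(_ isT) le5; have n3 : num c v i <> 3 by apply: no_three cf.
have n4 : num c v i <> 4 by apply: no_four cf.
by have := sum_num c v; lia.
Qed.

(** Exactly four neighbours of [v] would keep the colour [i]. *)
Lemma no_recolour c v u i k : config c v -> e v u -> c u = Some i -> k != i ->
  config (upd c u (Some k)) v -> False.
Proof.
move=> cf vu cu ki cf'; have [l nl] := monochromatic_neighbours cf.
have il : i = l.
  apply/eqP; apply: contraT => il; have := sum_ge2 (num c v) il.
  by have := num_gt0 vu cu; have := sum_num c v; move: nl; clear; lia.
apply: (@no_four _ _ i cf').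
have := num_recolour k i vu cu; rewrite il nl -il eqxx eq_sym (negbTE ki).
by clear; lia.
Qed.

(* All neighbours of [v] have colour [i]. If [u] cannot be recoloured because of its
   two neighbours of colour [a], then one of these, [y], sees five distinct colours;
   recolouring [y] makes the colours around [u] distinct. *)
Lemma no_config c v : config c v -> False.
Proof.
move=> cf; have [i ni] := monochromatic_neighbours cf.
have cv : c v = None by case: cf.
have rest j : j != i -> num c v j <= 1.
  by move=> ji; have := sum_ge2 (num c v) ji; have := sum_num c v; rewrite ni; clear; lia.
have cnt2 := stuck_in cf rest.
have cntj j k : j != i -> cnt c v j k <= 1.
  by move=> ji; apply: leq_trans (cnt_num _ _ _ _) (rest _ ji).
have [u [vu cu du]] : exists u, [/\ e v u, c u = Some i & 2 < supp_size (mult c v u)].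
  have [/existsP[u /and3P[vu /eqP cu du]]|] :=
    boolP [exists u, [&& e v u, c u == Some i & 2 < supp_size (mult c v u)]].
    by exists u.
  (* If every support is at most 2, each count is exactly 2, so the hole can move to a vertex seeing
     two colours, although the neighbours of a hole have a single colour. *)
  rewrite negb_exists => /forallP h.
  have s10 : \sum_k cnt c v i k <= 5 * 2.
    rewrite -[X in _ <= X * _]ni; apply: sum_cnt_le => u vu cu.
    by have := h u; rewrite vu cu eqxx /= -leqNgt.
  have [u [vu cu du]] : exists u, [/\ e v u, c u = Some i & 1 < supp_size (mult c v u)].
    by apply: sum_cnt_gt; rewrite ni (leq_trans _ (sum_colours cnt2)).
  have [k mk] : exists k, 0 < mult c v u k.
    have /existsP[k mk] : [exists k, 0 < mult c v u k]; last by exists k.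
    apply: contraTT du; rewrite negb_exists => /forallP h0.
    by rewrite /supp_size big1 // => k _; rewrite (negbTE (h0 k)).
  have ck : cnt c v i k = 2.
    by apply/esym; apply: (eq_of_sum_le cnt2); rewrite sum_const5.
  have cf' : config (shift c v u k) u.
    by apply: config_shift (cf) vu cu mk _ _ => [|j ji]; rewrite ?ck ?cntj.
  have [l nl] := monochromatic_neighbours cf'.
  have := supp_size_le (num (shift c v u k) u) l.
  have := sum_num (shift c v u k) u; rewrite nl.
  have : supp_size (mult c v u) <= supp_size (num (shift c v u k) u).
    by apply: supp_size_mono => j; rewrite num_shift // leq_addr.
  by move: du; clear; lia.
have [k0 k0i] : exists k, k != i.
  by exists (if i == ord0 then ord_max else ord0); have [->|] := eqVneq i ord0; rewrite // eq_sym.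
have locked c1 : config c1 v -> c1 u = Some i -> ~ forall j, mult c1 v u j <= 1.
  by move=> cf1 c1u /(config_free k0 cf1 vu c1u); apply: no_recolour vu c1u k0i.
have sm := sum_mult c vu.
have [a ha] : exists a, 1 < mult c v u a.
  have /existsP[a ha] : [exists a, 1 < mult c v u a]; last by exists a.
  apply: contraT; rewrite negb_exists => /forallP h.
  by case: (locked c cf cu) => j; have := h j; rewrite -leqNgt.
have ma : mult c v u a = 2.
  by have := supp_size_le (mult c v u) a; move: sm ha du; clear; lia.
have mj j : j != a -> mult c v u j <= 1.
  rewrite eq_sym => aj; have := supp_size_le2 (mult c v u) aj.
  by rewrite ma; move: sm du; clear; lia.
(* Only [a] occurs twice around [u], so it alone can prevent the recolouring. *)
have blocked k : k != i -> 1 < cnt c u a k.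
  move=> ki; rewrite ltnNge; apply/negP => ca.
  apply: (no_recolour cf vu cu ki); apply: config_recolour (cf) (cu) _ => j.
  have [->//|ja] := eqVneq j a.
  apply: leq_trans (cnt_num _ _ _ _) _.
  by rewrite -(mult_hole (v := v)) // mj.
have na : num c u a = 2 by rewrite -(mult_hole (v := v)).
have [y [uy cy]] : exists y, e u y /\ c y = Some a by apply: num_gt0P; rewrite na.
have yu : e y u by rewrite e_sym.
(* [y] sees every colour other than [i] beyond [u], and [u] supplies [i]; five neighbours leave no
   repetition. *)
have rainbow j : num c y j <= 1.
  have := supp_size_le (num c y) j; rewrite supp_size_all.
    by have := sum_num c y; clear; lia.
  move=> k; rewrite (num_mult _ yu cu); have [->|ki] := eqVneq k i; first by rewrite addn1.
  by rewrite addn0; apply: cnt_full uy cy; rewrite na blocked.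
have [z mz] : exists z, mult c v u z = 0.
  by apply: supp_size_lt5; have := supp_size_le (mult c v u) a; move: sm ha; clear; lia.
have cf1 : config (upd c y (Some z)) v.
  by apply: config_recolour (cf) cy _ => j; apply: leq_trans (cnt_num _ _ _ _) (rainbow j).
apply: (locked _ cf1).
  by rewrite updN //; apply: edge_neq.
have az : (a == z) = false by apply: contra_eqF ma => /eqP->; rewrite mz.
move=> j; rewrite mult_hole; last by case: cf1.
have := num_recolour z j uy cy; rewrite -[num c u j](mult_hole (v := v)) //.
have [->|ja] := eqVneq j a; first by rewrite ma az; clear; lia.
have [->|jz] := eqVneq j z; first by rewrite mz; clear; lia.
by have := mj _ ja; clear; lia.
Qed.

End Stuck.

(** * From minimal colourings to a total colouring *)

Lemma good_total : exists c, good c /\ holes c = 0.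
Proof.
apply: NNPP => none.
(* The lower bound on the holes rises step by step: a good colouring with exactly [n] holes would be
   a [config]. The wholly uncoloured map then contradicts the bound [#|T|.+1]. *)
have lower n : forall c, good c -> n <= holes c.
  elim: n => // n IHn c gc; rewrite ltn_neqAle IHn // andbT; apply/eqP => hn.
  have /card_gt0P[v] : 0 < holes c.
    by rewrite lt0n; apply/eqP => h0; apply: none; exists c.
  by rewrite inE => /eqP cv; apply: (no_config (M := n) IHn (c := c) (v := v)).
have : #|T|.+1 <= holes (fun=> None).
  apply: lower => i j [[|x s] [//= _ /andP[]]].
  by rewrite /= rcons_path /pair_rel /= andbF andbF.
by rewrite ltnNge max_card.
Qed.

End PartialColourings.

Theorem mainTheorem3 (T : finType) (e : rel T) :
  simple_graph e ->
  (forall x : T, deg e x <= 5) ->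
  exists c : T -> 'I_5, acyclic_D1_colouring e c.
Proof.
case=> e_sym e_irr deg5.
have [c [gc hc]] := good_total e_sym e_irr deg5.
pose c' x := odflt ord0 (c x).
have cc' x : c x = Some (c' x).
  rewrite /c'; case cx: (c x) => //.
  by have /setP/(_ x) := cards0_eq hc; rewrite !inE cx.
have transfer r i j : (forall x y, r x y = pair_rel e c i j x y) -> acyclic r.
  move=> rE [s [sz /andP[cs us]]]; apply: (gc i j); exists s; split=> //.
  by apply/andP; split=> //; rewrite -(eq_cycle rE).
exists c'; split=> [i|i j _].
  apply: (transfer _ i i) => x y.
  by rewrite /class_rel /pair_rel !cc' orbb.
by apply: (transfer _ i j) => x y; rewrite /bicol_rel /pair_rel !cc'.
Qed.
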